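(* Let $S$ be a standard graded Noetherian algebra over a commutative ring $R$ and let $M$ be a graded $S$-module. If $H^0_{S_+}(M)_\nu=0$, then $\operatorname{Ass}_R(M_\nu)\subseteq\operatorname{Ass}_R(M_\mu)$ for all $\mu\geq\nu$.
   Context: $S=\bigoplus_{\mu\ge0}S_\mu$ is a Noetherian graded ring with $S_0=R$, generated as an $R$-algebra by $S_1$; $S_+=\bigoplus_{\mu>0}S_\mu$. Graded modules are $\mathbf{Z}$-graded and not assumed finitely generated; $M_\mu$ is the degree $\mu$ component, an $R$-module. $H^0_{S_+}(M)$ is the graded submodule of elements of $M$ annihilated by some power of $S_+$. $\operatorname{Ass}_R$ denotes the set of associated primes. *)

(* Defs.v *)
From HB Require Import structures.
From mathcomp Require Import all_boot all_order all_algebra.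
From mathcomp Require Import all_classical.

Set Implicit Arguments.
Unset Strict Implicit.
Unset Printing Implicit Defensive.

Import Order.TTheory GRing.Theory Num.Theory.

Local Open Scope classical_set_scope.
Local Open Scope ring_scope.

(* Rings are [comPzRingType]: the zero ring is allowed.  This is why ideals are
   defined here and not taken from [ring_quotient], which needs a nontrivial
   ring and whose [idealr_closed] excludes the unit ideal. *)

Definition is_ideal (A : comPzRingType) (I : set A) : Prop :=
  I 0 /\ forall a x y : A, I x -> I y -> I (a * x + y).

Definition is_prime_ideal (A : comPzRingType) (P : set A) : Prop :=
  [/\ is_ideal P, ~ P 1 & forall x y : A, P (x * y) -> P x \/ P y].

Definition ideal_gen (A : comPzRingType) (X : set A) : set A :=
  smallest (@is_ideal A) X.

Definition ideal_mul (A : comPzRingType) (I J : set A) : set A :=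
  ideal_gen [set x * y | x in I & y in J].

Definition ideal_exp (A : comPzRingType) (I : set A) (n : nat) : set A :=
  iter n (ideal_mul I) setT.

Definition noetherian (A : comPzRingType) : Prop :=
  forall I : set A, is_ideal I -> exists s : seq A, I = ideal_gen [set` s].

(* Internal direct sum of a family of additive subgroups. *)
Record is_direct_sum (I : choiceType) (V : zmodType) (G : I -> set V) : Prop :=
  IsDirectSum {
    dsum_zmod : forall i, zmod_closed (mem (G i));
    dsum_span : forall x : V, exists (r : seq I) (f : I -> V),
      [/\ uniq r, forall i, G i (f i) & x = \sum_(i <- r) f i];
    dsum_indep : forall (r : seq I) (f : I -> V),
      uniq r -> (forall i, G i (f i)) -> \sum_(i <- r) f i = 0 ->
      forall i, i \in r -> f i = 0
  }.

(* An R-algebra is a ring morphism [phi : R -> S]. *)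
Definition is_subalgebra (R S : comPzRingType) (phi : {rmorphism R -> S})
    (B : set S) : Prop :=
  subring_closed (mem B) /\ range phi `<=` B.

Record standard_graded (R S : comPzRingType) (phi : {rmorphism R -> S})
    (gS : nat -> set S) : Prop := StandardGraded {
  sg_dsum : is_direct_sum gS;
  sg_one : gS 0%N 1;
  sg_mul : forall i j (a b : S), gS i a -> gS j b -> gS (i + j)%N (a * b);
  (* [phi] identifies [R] with the degree 0 component *)
  sg_inj : injective phi;
  sg_deg0 : gS 0%N = range phi;
  sg_gen : smallest (is_subalgebra phi) (gS 1%N) = setT
}.

Record graded_module (S : comPzRingType) (gS : nat -> set S)
    (M : lmodType S) (gM : int -> set M) : Prop := GradedModule {
  gm_dsum : is_direct_sum gM;
  gm_scale : forall (i : nat) (j : int) (a : S) (m : M),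
    gS i a -> gM j m -> gM (i%:Z + j) (a *: m)
}.

(* S_+ *)
Definition irrelevant_ideal (S : comPzRingType) (gS : nat -> set S) : set S :=
  [set a | exists (r : seq nat) (f : nat -> S),
     [/\ forall i, i \in r -> (0 < i)%N, forall i, gS i (f i)
       & a = \sum_(i <- r) f i]].

(* H^0_I(M) *)
Definition H0 (S : comPzRingType) (I : set S) (M : lmodType S) : set M :=
  [set m | exists n : nat, forall a : S, ideal_exp I n a -> a *: m = 0].

(* Ass_R(N) for an R-submodule N of the S-module M, where R acts on M through
   [phi]. *)
Definition Ass (R S : comPzRingType) (phi : {rmorphism R -> S})
    (M : lmodType S) (N : set M) : set (set R) :=
  [set P | is_prime_ideal P /\
           exists2 m : M, N m & P = [set r : R | phi r *: m = 0]].

(* Main.v *)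
Require Import Defs.
From HB Require Import structures.
From mathcomp Require Import all_boot all_order all_algebra.
From mathcomp Require Import all_classical.

Set Implicit Arguments.
Unset Strict Implicit.
Unset Printing Implicit Defensive.

Import Order.TTheory GRing.Theory Num.Theory.

Local Open Scope classical_set_scope.
Local Open Scope ring_scope.

(** Let P = ann_R(m) be prime with m in M_nu, and let d = mu - nu.  The
    R-module S_d m lies in M_mu and is killed by P.  It is moreover faithful
    over R/P: if r kills S_d m, then S_d (r m) = 0, and since S is generated in
    degree 1 this gives (S_+)^d (r m) = 0 ([ideal_exp_irrelevant_annihilates]),
    so r m lies in H^0_{S_+}(M)_nu = 0 and r belongs to P.

    Because S is Noetherian, finitely many y_1, ..., y_n in S_d generate the
    ideal S_d S ([noetherian_finite_subset]), so r kills S_d m as soon as it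
    kills every y_i m.  If no ann_R(y_i m) were equal to P, one could choose
    r_i outside P killing y_i m; the product of the r_i would then be outside P
    and kill S_d m, contradicting faithfulness.  Hence P = ann_R(y_i m) for
    some i, and y_i m is in M_mu. *)

(** * Ideals and finite generation *)

Lemma ideal_gen_ideal (A : comPzRingType) (X : set A) : is_ideal (ideal_gen X).
Proof.
split=> [J [[J0 _] _] //|a x y Ix Iy J JX].
by have [[_ Jlin] _] := JX; apply: Jlin; [exact: Ix|exact: Iy].
Qed.

Lemma sub_ideal_gen (A : comPzRingType) (X : set A) : X `<=` ideal_gen X.
Proof. exact: sub_gen_smallest. Qed.

Lemma ideal_gen_min (A : comPzRingType) (X J : set A) :
  is_ideal J -> X `<=` J -> ideal_gen X `<=` J.
Proof. exact: smallest_sub. Qed.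

Lemma ideal_genS (A : comPzRingType) (X Y : set A) :
  X `<=` Y -> ideal_gen X `<=` ideal_gen Y.
Proof.
move=> XY; apply: ideal_gen_min; first exact: ideal_gen_ideal.
exact: (subset_trans XY (@sub_ideal_gen _ _)).
Qed.

Lemma annihilator_ideal (A : comPzRingType) (M : lmodType A) (x : M) :
  is_ideal [set a : A | a *: x = 0].
Proof.
split=> [|a b c /= bx cx]; first by rewrite /= scale0r.
by rewrite scalerDl -scalerA bx cx scaler0 addr0.
Qed.

(** Membership in a generated ideal involves finitely many generators only:
    the elements for which this is so form an ideal. *)
Lemma ideal_gen_finite (A : comPzRingType) (X : set A) (a : A) :
  ideal_gen X a -> exists2 s : seq A, [set` s] `<=` X & ideal_gen [set` s] a.
Proof.
move: a; apply: ideal_gen_min.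
  split=> [|a x y [s sX sx] [t tX ty]].
    by exists [::] => //; have [] := ideal_gen_ideal [set` [::] : seq A].
  exists (s ++ t) => [z /=|].
    by rewrite mem_cat => /orP[/sX|/tX].
  have [_ lin] := ideal_gen_ideal [set` s ++ t].
  apply: lin; [apply: ideal_genS sx|apply: ideal_genS ty] => z /= zs;
    by rewrite mem_cat zs ?orbT.
move=> x Xx; exists [:: x] => [z /=|]; first by rewrite inE => /eqP ->.
by apply: sub_ideal_gen; rewrite /= inE.
Qed.

(** The Noetherian hypothesis provides arbitrary generators of the ideal
    generated by X; rewriting each of them in terms of X gives generators
    taken from X itself. *)
Lemma noetherian_finite_subset (A : comPzRingType) (X : set A) :
  noetherian A ->
  exists2 s : seq A, [set` s] `<=` X & X `<=` ideal_gen [set` s].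
Proof.
move=> /(_ _ (ideal_gen_ideal X))[t Xt].
suff [s sX ts] : exists2 s : seq A,
    [set` s] `<=` X & [set` t] `<=` ideal_gen [set` s].
  exists s => //; apply: subset_trans (@sub_ideal_gen _ _) _.
  rewrite Xt.
  by apply: ideal_gen_min => //; exact: ideal_gen_ideal.
have {Xt} : [set` t] `<=` ideal_gen X.
  by rewrite Xt; exact: sub_ideal_gen.
elim: t => [_|a t IHt tX]; first by exists [::].
have [z zt|s sX ts] := IHt; first by apply: tX; rewrite /= inE zt orbT.
have [|s' s'X s'a] := @ideal_gen_finite _ X a.
  by apply: tX; rewrite /= inE eqxx.
exists (s' ++ s) => [z /=|z /=]; first by rewrite mem_cat => /orP[/s'X|/sX].
rewrite inE => /orP[/eqP ->|/ts]; [apply: ideal_genS s'a|apply: ideal_genS];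
  by move=> w /= ws; rewrite mem_cat ws ?orbT.
Qed.

(** * Homogeneous elements of a graded ring *)

(** Terms carry their degree, and degrees may repeat; the product of two
    such sums is then again of this form, without regrouping by degree. *)
Definition homogeneous_sums (V : zmodType) (D : nat -> set V) : set V :=
  [set v | exists2 l : seq (nat * V),
     (forall p, p \in l -> D p.1 p.2) & v = \sum_(p <- l) p.2].

Lemma zmod_closed0 (V : zmodType) (G : set V) : zmod_closed (mem G) -> G 0.
Proof. by case=> + _; rewrite inE. Qed.

Lemma zmod_closedB (V : zmodType) (G : set V) (x y : V) :
  zmod_closed (mem G) -> G x -> G y -> G (x - y).
Proof. by case=> _ H Gx Gy; have := H x y; rewrite !inE; apply. Qed.

Lemma zmod_closedN (V : zmodType) (G : set V) (x : V) :
  zmod_closed (mem G) -> G x -> G (- x).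
Proof.
by move=> Gz Gx; rewrite -sub0r; apply: zmod_closedB => //; exact: zmod_closed0.
Qed.

Lemma zmod_closed_sum (V : zmodType) (G : set V) (I : eqType) (r : seq I)
    (C : pred I) (f : I -> V) :
  zmod_closed (mem G) -> (forall i, i \in r -> C i -> G (f i)) ->
  G (\sum_(i <- r | C i) f i).
Proof.
move=> Gz Gf; rewrite big_seq_cond; elim/big_rec: _; first exact: zmod_closed0.
move=> i x /andP[ir Ci] Gx; rewrite -[x]opprK.
by apply: zmod_closedB => //; [exact: Gf|exact: zmod_closedN].
Qed.

Lemma sum_eq1_seq (V : zmodType) (I : eqType) (r : seq I) (i : I) (x : V) :
  uniq r -> i \in r -> \sum_(k <- r | k == i) x = x.
Proof.
move=> r_uniq ir; rewrite big_mkcond (bigD1_seq i) //= eqxx big1 ?addr0 //.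
by move=> k /negPf ->.
Qed.

(** Uniqueness of the decomposition into homogeneous components: a homogeneous
    element of degree i equals the sum of the terms of degree i in any
    expression of it. *)
Lemma homogeneous_sums_component (V : zmodType) (G D : nat -> set V) :
  is_direct_sum G -> (forall i, D i `<=` G i) ->
  (forall i, zmod_closed (mem (D i))) ->
  forall i, homogeneous_sums D `&` G i `<=` D i.
Proof.
move=> [Gz _ indep] DG Dz i s [[l lD sE] Gs].
pose n := (\max_(p <- (i, s) :: l) p.1).+1.
pose c k := \sum_(p <- l | k == p.1) p.2.
have ltn p : p \in (i, s) :: l -> (p.1 < n)%N.
  by move=> pl; rewrite ltnS; exact: (@leq_bigmax_seq _ _ xpredT fst).
have Dc k : D k (c k).
  by apply: zmod_closed_sum => // p pl /eqP ->; exact: lD.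
have sum_c : \sum_(0 <= k < n) c k = s.
  rewrite sE (exchange_big_dep xpredT) //= big_seq [RHS]big_seq.
  apply: eq_bigr => p pl; rewrite sum_eq1_seq ?iota_uniq //.
  by rewrite mem_index_iota ltn // inE pl orbT.
pose f k := c k - (if k == i then s else 0).
suff : f i = 0 by rewrite /f eqxx => /eqP; rewrite subr_eq0 => /eqP <-.
have i_n : i \in index_iota 0 n by rewrite mem_index_iota (ltn (i, s)) ?mem_head.
apply: (indep (index_iota 0 n)) => //; first exact: iota_uniq.
  move=> k; apply: zmod_closedB => //; first exact: DG.
  by case: eqP => [->//|_]; exact: zmod_closed0.
rewrite sumrB sum_c -big_mkcond /=.
by rewrite sum_eq1_seq ?iota_uniq ?subrr.
Qed.

(** * The irrelevant ideal of a standard graded ring *)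

(** The elements whose components of positive degree all lie in J form a
    subalgebra containing S_1, hence all of S.  Arguing on components avoids
    any homogeneity hypothesis on J. *)
Lemma irrelevant_ideal_sub (R S : comPzRingType) (phi : {rmorphism R -> S})
    (gS : nat -> set S) (J : set S) :
  standard_graded phi gS -> is_ideal J -> gS 1%N `<=` J ->
  irrelevant_ideal gS `<=` J.
Proof.
move=> [dsum one mul _ deg0 gen] [J0 Jlin] S1J.
have gz := dsum_zmod dsum.
have JM a x : J x -> J (a * x) by move=> Jx; rewrite -[_ * _]addr0; exact: Jlin.
have JB x y : J x -> J y -> J (x - y).
  by move=> Jx Jy; rewrite addrC -mulN1r; exact: Jlin.
pose D i : set S := [set a | gS i a /\ ((0 < i)%N -> J a)].
have Dz i : zmod_closed (mem (D i)).
  split=> [|x y]; rewrite !inE; first by split=> //; exact: zmod_closed0.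
  by move=> [Sx Jx] [Sy Jy]; split=> [|i0]; [exact: zmod_closedB|apply: JB; auto].
have D0 a : gS 0%N a -> D 0%N a by split.
have one_term i a : D i a -> homogeneous_sums D a.
  by move=> Da; exists [:: (i, a)] => [p|]; rewrite ?big_seq1 // inE => /eqP ->.
have all_sums : [set: S] `<=` homogeneous_sums D.
  rewrite -gen; apply: smallest_sub => [|a S1a]; last first.
    by apply: (one_term 1%N); split=> // _; exact: S1J.
  split=> [|a [r _ <-]]; last first.
    by apply: (one_term 0%N); apply: D0; rewrite deg0; exists r.
  split=> [|x y|x y]; rewrite !inE; first by apply: (one_term 0%N); exact: D0.
    move=> [l lD ->] [k kD ->].
    exists (l ++ [seq (p.1, - p.2) | p <- k]) => [p|]; last first.
      by rewrite big_cat big_map sumrN.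
    rewrite mem_cat => /orP[/lD //|/mapP[q qk -> /=]].
    by apply: zmod_closedN => //; exact: kD.
  move=> [l lD ->] [k kD ->].
  exists [seq ((p.1 + q.1)%N, p.2 * q.2) | p <- l, q <- k] => [p|]; last first.
    by rewrite big_allpairs_dep /= big_distrlr.
  move=> /allpairsP[[u v] /= [/lD[Su Ju] /kD[Sv Jv] ->]] /=; split.
    exact: mul.
  rewrite addn_gt0 => /orP[/Ju Ju'|/Jv]; last exact: JM.
  by rewrite mulrC; exact: JM.
move=> _ [r [f [r_gt0 Sf ->]]].
rewrite big_seq; elim/big_rec: _ => // i x ir Jx.
rewrite -[f i]mul1r; apply: Jlin => //.
have DG k : D k `<=` gS k by move=> a [].
suff [_ Jf] : D i (f i) by apply: Jf; exact: r_gt0.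
by apply: (homogeneous_sums_component dsum DG Dz); split=> //; exact: all_sums.
Qed.

(** The annihilator of b x, for b in (S_+)^d, contains S_1 by the induction
    hypothesis applied to the multiples of x by elements of S_1; so it
    contains S_+. *)
Lemma ideal_exp_irrelevant_annihilates (R S : comPzRingType)
    (phi : {rmorphism R -> S}) (gS : nat -> set S) (M : lmodType S) (d : nat) :
  standard_graded phi gS ->
  forall x : M, (forall y, gS d y -> y *: x = 0) ->
  forall a, ideal_exp (irrelevant_ideal gS) d a -> a *: x = 0.
Proof.
move=> hS; elim: d => [|d IHd] x Sdx a.
  by rewrite -[a]mulr1 -scalerA (Sdx 1) ?scaler0 //; exact: sg_one hS.
move: a; apply: ideal_gen_min; first exact: annihilator_ideal.
move=> _ [a Sa [b Ib <-]] /=; rewrite -scalerA.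
apply: (irrelevant_ideal_sub hS (annihilator_ideal (b *: x))) Sa => c S1c /=.
rewrite scalerA mulrC -scalerA; apply: IHd Ib => y Sdy.
by rewrite scalerA mulrC; apply: Sdx; rewrite -add1n; exact: (sg_mul hS).
Qed.

(** * Associated primes *)

(** One multiplies the chosen elements together; primality keeps the product
    outside P. *)
Lemma prime_ideal_common_multiple (A : comPzRingType) (P : set A) (T : eqType)
    (K : T -> set A) (s : seq T) :
  is_prime_ideal P -> (forall t, is_ideal (K t)) ->
  (forall t, t \in s -> exists2 r, ~ P r & K t r) ->
  exists2 r, ~ P r & forall t, t \in s -> K t r.
Proof.
move=> [_ P1 Pprime] Kid; elim: s => [_|t s IHs Ks]; first by exists 1.
have [u us|r Pr Kr] := IHs; first by apply: Ks; rewrite inE us orbT.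
have [|q Pq Kq] := Ks t; first exact: mem_head.
have KM u a x : K u x -> K u (a * x).
  by have [K0 lin] := Kid u => Kx; rewrite -[_ * _]addr0; exact: lin.
exists (q * r) => [/Pprime[]//|u]; rewrite inE => /orP[/eqP ->|us].
  by rewrite mulrC; exact: KM.
by apply: KM; exact: Kr.
Qed.

Theorem theorem5p2 (R S : comPzRingType) (phi : {rmorphism R -> S})
    (gS : nat -> set S) (hS : standard_graded phi gS) (hN : noetherian S)
    (M : lmodType S) (gM : int -> set M) (hM : graded_module gS gM)
    (nu : int)
    (hH0 : H0 (irrelevant_ideal gS) (M := M) `&` gM nu = [set 0]) :
  forall mu : int, nu <= mu -> Ass phi (gM nu) `<=` Ass phi (gM mu).
Proof.
move=> mu le_nu_mu P [Pprime [m Mm PE]]; split=> //.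
have [d mu_d] : exists d : nat, mu = d%:Z + nu.
  by exists `|mu - nu|%N; rewrite gez0_abs ?subr_ge0 // subrK.
have [s sSd Sds] := noetherian_finite_subset (gS d) hN.
apply: contrapT => noP.
pose K y : set R := [set r | phi r *: (y *: m) = 0].
have Kid y : is_ideal (K y).
  have [_ lin] := annihilator_ideal (y *: m).
  split=> [|a u v Ku Kv]; first by rewrite /K /= rmorph0 scale0r.
  by rewrite /K /= rmorphD rmorphM; exact: lin.
have PK y : P `<=` K y.
  by rewrite PE => r /= rm; rewrite /K /= scalerA mulrC -scalerA rm scaler0.
have [y ys|r Pr Kr] := prime_ideal_common_multiple (s := s) Pprime Kid.
  apply: contrapT => noK; apply: noP; exists (y *: m).
    by rewrite mu_d; apply: (gm_scale hM) => //; exact: sSd.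
  apply/seteqP; split=> [|r Kr]; first exact: PK.
  by apply: contrapT => Pr; apply: noK; exists r.
have Sd_rm y : gS d y -> y *: (phi r *: m) = 0.
  move=> /Sds; move: y; apply: ideal_gen_min; first exact: annihilator_ideal.
  by move=> y /= /Kr; rewrite /K /= !scalerA mulrC.
apply: Pr; rewrite PE.
have : (H0 (irrelevant_ideal gS) (M := M) `&` gM nu) (phi r *: m).
  split; first by exists d; exact: ideal_exp_irrelevant_annihilates hS _ Sd_rm.
  rewrite -[nu]add0r; apply: (gm_scale hM) => //.
  by rewrite (sg_deg0 hS); exists r.
by rewrite hH0.
Qed.
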